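(* Let $k\in\mathbb{N}$, let $\Omega\subset\mathbb{R}^m\times\mathbb{R}^{m\times N}$ be open, and let $\Gamma_1$ and $\Gamma_2$ be finite precision algorithms with precision $2^{-k}$ for the inexact LASSO computational problem on $\Omega$. Suppose that $\Gamma_1$ is correct on all inputs that can be represented exactly in $\Omega$. Let $(b,U)\in\mathbb{R}^m\times\mathbb{R}^{m\times N}$ satisfy $\mathscr{C}_{\mathrm{UL}}(b,U)=\alpha$ with $0<\frac1\alpha<2^{-k-1}$, and suppose that for some $r\in(\alpha^{-1},2^{-k-1})$ we have $\mathcal{B}_\infty(b,U,r)\subset\Omega$. Then $\Gamma_1$ fails on a set $F$ such that (1) $\mathcal{B}_\infty(b,U,r)\setminus F$ has Lebesgue measure $0$, and (2) $\mathcal{B}_\infty(b,U,\alpha^{-1})\subset F$. Moreover, $\Gamma_2$ fails either on the whole of $\mathcal{B}_\infty(b,U,\alpha^{-1})$ or on another nonempty open set $\theta\subset\mathcal{B}_\infty(b,U,r)$.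
   Context: Fix a rational $\lambda>0$ and positive integers $m,N$. $\|M\|_{\max}=\max_{i,j}|M_{ij}|$, and $\mathcal{B}_\infty(b,U,r)=\{(y,A):\max(\|y-b\|_\infty,\|A-U\|_{\max})<r\}$. LASSO. $\mathsf{Sol}^{\mathsf{UL}}(y,A)=\operatorname{argmin}_{\hat x\in\mathbb{R}^N}\|A\hat x-y\|_2^2+\lambda\|\hat x\|_1$ for $(y,A)\in\mathbb{R}^m\times\mathbb{R}^{m\times N}$, and $\Xi(y,A)=\{\mathsf{supp}(x): x\in\mathsf{Sol}^{\mathsf{UL}}(y,A)\}$, a set of subsets of $\{1,\dots,N\}$. $\mathbb{B}^N=\{0,1\}^N$ is identified with the set of subsets of $\{1,\dots,N\}$. Condition number. The stability support $\mathsf{stsp}(y,A)$ is the infimum of all $\delta\ge0$ for which there exist $\tilde y\in\mathbb{R}^m$, $\tilde A\in\mathbb{R}^{m\times N}$, $x\in\mathsf{Sol}^{\mathsf{UL}}(y,A)$, $\tilde x\in\mathsf{Sol}^{\mathsf{UL}}(\tilde y,\tilde A)$ with $\|\tilde y-y\|_\infty\le\delta$, $\|\tilde A-A\|_{\max}\le\delta$ and $\mathsf{supp}(x)\ne\mathsf{supp}(\tilde x)$. $\mathscr{C}_{\mathrm{UL}}(y,A)=\mathsf{stsp}(y,A)^{-1}$ if $\mathsf{stsp}(y,A)\neq0$, and $=\infty$ otherwise. Inexact LASSO computational problem on $\Omega$. $\tilde\Omega$ is the set of all sequences $\tilde\iota=\{(y_n,A_n)\}_{n\in\mathbb{N}}$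 ($\mathbb{N}=\{1,2,\dots\}$), $y_n\in\mathbb{R}^m$, $A_n\in\mathbb{R}^{m\times N}$, for which there is $\iota=(y,A)\in\Omega$ with $\|y_n-y\|_\infty\le2^{-n}$ and $\|A_n-A\|_{\max}\le2^{-n}$ for all $n$. This $\iota$ is unique and is said to correspond to $\tilde\iota$; the sequence is also called $\Delta_1$ information for $\iota$. $\tilde\Lambda=\{\tilde f_n^{\mathrm{vec}},\tilde f_n^{\mathrm{mat}}\}_{n\in\mathbb{N}}$ with $\tilde f_n^{\mathrm{vec}}(\tilde\iota)=y_n$, $\tilde f_n^{\mathrm{mat}}(\tilde\iota)=A_n$. General algorithm. A map $\Gamma:\tilde\Omega\to\mathbb{B}^N$ such that for every $\tilde\iota\in\tilde\Omega$: (i) there is a nonempty finite set $\Lambda_\Gamma(\tilde\iota)\subset\tilde\Lambda$; (ii) the action of $\Gamma$ on $\tilde\iota$ is uniquely determined by $\{f(\tilde\iota)\}_{f\in\Lambda_\Gamma(\tilde\iota)}$; (iii) for every $\tilde\iota'\in\tilde\Omega$ with $f(\tilde\iota')=f(\tilde\iota)$ for all $f\in\Lambda_\Gamma(\tilde\iota)$ one has $\Lambda_\Gamma(\tilde\iota')=\Lambda_\Gamma(\tilde\iota)$. Finite precision. $D_\Gamma(\tilde\iota)=\sup\{n: \tilde f_n^{\mathrm{vec}}\in\Lambda_\Gamma(\tilde\iota)\text{ or }\tilde f_n^{\mathrm{mat}}\in\Lambda_\Gamma(\tilde\iota)\}$. $\Gamma$ is a finite precision algorithm with precision $2^{-k}$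 if it is a general algorithm and $D_\Gamma(\tilde\iota)\le k$ for all $\tilde\iota\in\tilde\Omega$. Correct on exactly represented inputs. Let $\mathbf{D}$ be the dyadic rationals. $\Gamma$ is correct on all inputs that can be represented exactly in $\Omega$ if for all $(y,A)\in\Omega$ with $y\in\mathbf{D}^m$, $A\in\mathbf{D}^{m\times N}$, the constant sequence $\tilde\iota=((y,A),(y,A),\dots)$ satisfies $\Gamma(\tilde\iota)\in\Xi(y,A)$. Failure. $\Gamma$ fails on a set $G\subset\Omega$ if one can choose, for every $\iota\in G$, a sequence $\tilde\iota\in\tilde\Omega$ corresponding to $\iota$ such that $\Gamma(\tilde\iota)\notin\Xi(\iota)$. *)

(* Defs.v *)
From HB Require Import structures.
From mathcomp Require Import all_boot all_order all_algebra.
From mathcomp Require Import all_classical all_reals all_analysis.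
Import Order.TTheory GRing.Theory Num.Theory.
Import numFieldNormedType.Exports.

Set Implicit Arguments.
Unset Strict Implicit.
Unset Printing Implicit Defensive.

Local Open Scope classical_set_scope.
Local Open Scope ring_scope.

(* On 'cV[R]_m and 'M[R]_(m, N) the library norm is the maximum of the absolute
   values of the entries, so it is the sup norm, resp. the max norm. *)
Notation lasso_input R m N := ('cV[R]_m * 'M[R]_(m, N))%type.

Definition ball_inf (R : realType) (m N : nat) (p : lasso_input R m N) (r : R)
    : set (lasso_input R m N) :=
  [set q | Num.max `|q.1 - p.1| `|q.2 - p.2| < r].

Definition lasso_objective (R : realType) (lam : rat) (m N : nat)
    (p : lasso_input R m N) (x : 'cV[R]_N) : R :=
  (\sum_i (p.2 *m x - p.1) i ord0 ^+ 2) + ratr lam * \sum_j `|x j ord0|.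

Definition lasso_sol (R : realType) (lam : rat) (m N : nat)
    (p : lasso_input R m N) : set 'cV[R]_N :=
  [set x | forall z, lasso_objective lam p x <= lasso_objective lam p z].

Definition supp (R : realType) (N : nat) (x : 'cV[R]_N) : {set 'I_N} :=
  [set j | x j ord0 != 0]%SET.

Definition Xi (R : realType) (lam : rat) (m N : nat) (p : lasso_input R m N)
    : set {set 'I_N} :=
  @supp R N @` lasso_sol lam p.

(* The infimum is taken in \bar R, so that it is +oo over the empty set. *)
Definition stsp (R : realType) (lam : rat) (m N : nat) (p : lasso_input R m N)
    : \bar R :=
  ereal_inf (EFin @` [set delta | 0 <= delta /\
    exists (q : lasso_input R m N) (x x' : 'cV[R]_N),
      [/\ lasso_sol lam p x, lasso_sol lam q x',
          `|q.1 - p.1| <= delta, `|q.2 - p.2| <= delta & supp x <> supp x']]).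

Definition cond_UL (R : realType) (lam : rat) (m N : nat)
    (p : lasso_input R m N) : \bar R :=
  (if stsp lam p == 0 then +oo else (stsp lam p)^-1)%E.

(* Sequences in the inexact problem are indexed from 1: for
   s : nat -> lasso_input R m N, the term of index n.+1 is s n. *)
Definition corresponds (R : realType) (m N : nat)
    (s : nat -> lasso_input R m N) (p : lasso_input R m N) : Prop :=
  forall n, `|(s n).1 - p.1| <= 2 ^- n.+1 /\ `|(s n).2 - p.2| <= 2 ^- n.+1.

Definition delta1_info (R : realType) (m N : nat)
    (Omega : set (lasso_input R m N)) : set (nat -> lasso_input R m N) :=
  [set s | exists2 p, Omega p & corresponds s p].

(* [read_vec n] and [read_mat n] stand for the evaluation functions
   \tilde f^vec and \tilde f^mat of index n.+1. *)
Inductive evaluation := read_vec of nat | read_mat of nat.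

Definition evaluation_index (f : evaluation) : nat :=
  match f with read_vec n => n.+1 | read_mat n => n.+1 end.

Definition evaluate (R : realType) (m N : nat) (f : evaluation)
    (s : nat -> lasso_input R m N) : 'cV[R]_m + 'M[R]_(m, N) :=
  match f with read_vec n => inl (s n).1 | read_mat n => inr (s n).2 end.

(* Subsets of {1, ..., N} represent {0,1}^N. The functions [run] and [reads]
   are total, but nothing is required of (or used about) their values outside
   [delta1_info Omega]. *)
Record general_algorithm (R : realType) (m N : nat)
    (Omega : set (lasso_input R m N)) := GeneralAlgorithm {
  run :> (nat -> lasso_input R m N) -> {set 'I_N} ;
  reads : (nat -> lasso_input R m N) -> set evaluation ;
  reads_finite : forall s, delta1_info Omega s -> finite_set (reads s) ;
  reads_nonempty : forall s, delta1_info Omega s -> reads s !=set0 ;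
  run_determined : forall s s', delta1_info Omega s -> delta1_info Omega s' ->
    (forall f, reads s f -> evaluate f s' = evaluate f s) -> run s' = run s ;
  reads_determined : forall s s',
    delta1_info Omega s -> delta1_info Omega s' ->
    (forall f, reads s f -> evaluate f s' = evaluate f s) ->
    reads s' = reads s }.

Definition read_depth (R : realType) (m N : nat)
    (Omega : set (lasso_input R m N)) (Gamma : general_algorithm Omega)
    (s : nat -> lasso_input R m N) : \bar R :=
  ereal_sup [set (evaluation_index f)%:R%:E | f in reads Gamma s].

Definition finite_precision (R : realType) (m N : nat)
    (Omega : set (lasso_input R m N)) (Gamma : general_algorithm Omega)
    (k : nat) : Prop :=
  forall s, delta1_info Omega s -> (read_depth Gamma s <= k%:R%:E)%E.

Definition dyadic (R : realType) : set R :=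
  [set x | exists (a : int) (n : nat), x = a%:~R / 2 ^+ n].

Definition correct_on_exact (R : realType) (lam : rat) (m N : nat)
    (Omega : set (lasso_input R m N)) (Gamma : general_algorithm Omega)
    : Prop :=
  forall p, Omega p -> (forall i, dyadic (p.1 i ord0)) ->
    (forall i j, dyadic (p.2 i j)) -> Xi lam p (Gamma (fun=> p)).

Definition fails_on (R : realType) (lam : rat) (m N : nat)
    (Omega : set (lasso_input R m N)) (Gamma : general_algorithm Omega)
    (G : set (lasso_input R m N)) : Prop :=
  G `<=` Omega /\
  forall p, G p -> exists s,
    [/\ delta1_info Omega s, corresponds s p & ~ Xi lam p (Gamma s)].

Definition le_coord (R : realType) (m N : nat) (a c : lasso_input R m N)
    : Prop :=
  (forall i, a.1 i ord0 <= c.1 i ord0) /\ (forall i j, a.2 i j <= c.2 i j).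

Definition box (R : realType) (m N : nat) (a c : lasso_input R m N)
    : set (lasso_input R m N) :=
  [set q | le_coord a q /\ le_coord q c].

Definition box_volume (R : realType) (m N : nat) (a c : lasso_input R m N)
    : R :=
  (\prod_i (c.1 i ord0 - a.1 i ord0)) *
  (\prod_i \prod_j (c.2 i j - a.2 i j)).

(* Lebesgue outer measure on R^m x R^(m x N), a space of dimension m + m * N.
   A set has Lebesgue measure 0 (and is then Lebesgue measurable) if and only
   if its Lebesgue outer measure is 0. *)
Definition lebesgue_outer (R : realType) (m N : nat)
    (S : set (lasso_input R m N)) : \bar R :=
  ereal_inf [set v : \bar R | exists a c : nat -> lasso_input R m N,
    [/\ forall n, le_coord (a n) (c n),
        S `<=` \bigcup_n box (a n) (c n) &
        v = (\sum_(0 <= n <oo) (box_volume (a n) (c n))%:E)%E]].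

Definition lebesgue_null (R : realType) (m N : nat)
    (S : set (lasso_input R m N)) : Prop :=
  lebesgue_outer S = 0%E.

(* Main.v *)
Require Import Defs.
From mathcomp Require Import all_boot all_order all_algebra.
From mathcomp Require Import all_classical all_reals all_analysis.
From mathcomp Require Import ring lra.
Import Order.TTheory GRing.Theory Num.Theory.
Import numFieldNormedType.Exports.
Local Open Scope classical_set_scope.
Local Open Scope ring_scope.

(* An algorithm of precision 2^-k cannot tell an input p of the ball from any
   other input q of the ball: k copies of q followed by copies of p is
   admissible information for p. So a single output serves every p in the ball,
   and it can be taken to be the output on a dyadic q of our choice. Below the
   radius 1/alpha all solutions share one support S, and every larger ball
   contains an open set of inputs none of whose solutions has support S. Playing
   dyadic inputs of these two regions against each other, the algorithm fails at
   each p except where both outputs are supports of solutions at p. That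
   exceptional set is null: if x_j = 0 and z_j <> 0 for two solutions x, z at p,
   then x and z have the same residual rho, which depends only on y and on the
   columns of A other than the j-th, while a_j satisfies
   2 |<a_j, rho>| = lambda. *)

Set Implicit Arguments.
Unset Strict Implicit.
Unset Printing Implicit Defensive.

(** * The max norm entrywise *)

Lemma mx_norm_leP (R : realType) (m n : nat) (A : 'M[R]_(m, n)) (e : R) :
  0 <= e -> (`|A| <= e) <-> (forall i j, `|A i j| <= e).
Proof.
move=> e0; rewrite [`|A|]/Num.norm/= mx_normrE; split.
  by move/bigmax_leP => [_ h] i j; exact: (h (i, j)).
by move=> h; apply/bigmax_leP; split=> // -[i j] _; exact: h.
Qed.

Lemma mx_norm_ltP (R : realType) (m n : nat) (A : 'M[R]_(m, n)) (e : R) :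
  0 < e -> (`|A| < e) <-> (forall i j, `|A i j| < e).
Proof.
move=> e0; rewrite [`|A|]/Num.norm/= mx_normrE; split.
  by move/bigmax_ltP => [_ h] i j; exact: (h (i, j)).
by move=> h; apply/bigmax_ltP; split=> // -[i j] _; exact: h.
Qed.

(** * Optimality conditions *)

Section Lasso.
Context {R : realType} (lam : rat) {m N : nat}.
Hypothesis lam_gt0 : 0 < lam.
Implicit Types (p : lasso_input R m N) (x z : 'cV[R]_N).

Definition residual p x : 'cV[R]_m := p.1 - p.2 *m x.

Definition correlation p x (j : 'I_N) : R :=
  \sum_i p.2 i j * residual p x i ord0.

Lemma lasso_objectiveE p x : lasso_objective lam p x =
  (\sum_i residual p x i ord0 ^+ 2) + ratr lam * \sum_j `|x j ord0|.
Proof.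
congr (_ + _); apply: eq_bigr => i _.
by rewrite /residual -(opprB (_ *m _)) [in RHS]mxE sqrrN.
Qed.

Let l_gt0 : 0 < ratr lam :> R. Proof. by rewrite ltr0q. Qed.

(** At the midpoint of two solutions the l1 term is at most the average, while the sum of squares is
    below its average by a quarter of the squared distance of the residuals. Minimality forces that
    distance to be 0. *)
Lemma lasso_sol_fit_unique p x z :
  lasso_sol lam p x -> lasso_sol lam p z -> residual p x = residual p z.
Proof.
move=> sx sz.
have exz : lasso_objective lam p x = lasso_objective lam p z.
  by apply/eqP; rewrite eq_le sx sz.
pose w := 2^-1 *: (x + z).
have rw i : residual p w i ord0 =
    2^-1 * (residual p x i ord0 + residual p z i ord0).
  by rewrite /residual /w -scalemxAr mulmxDr !mxE; lra.
have absw : \sum_j `|w j ord0| <=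
    2^-1 * (\sum_j `|x j ord0| + \sum_j `|z j ord0|).
  rewrite -big_split mulr_sumr /=; apply: ler_sum => j _.
  by rewrite !mxE normrM gtr0_norm // ler_pM2l ?invr_gt0 // ler_normD.
have sqw : \sum_i residual p w i ord0 ^+ 2 =
    2^-1 * (\sum_i residual p x i ord0 ^+ 2 +
            \sum_i residual p z i ord0 ^+ 2)
    - 4^-1 * \sum_i (residual p x i ord0 - residual p z i ord0) ^+ 2.
  rewrite -big_split !mulr_sumr -sumrB /=; apply: eq_bigr => i _.
  by rewrite rw; field.
have D0 : \sum_i (residual p x i ord0 - residual p z i ord0) ^+ 2 <= 0.
  have := sx w; move: exz absw; rewrite !lasso_objectiveE sqw.
  move: (\sum_j `|x j ord0|) (\sum_j `|z j ord0|) (\sum_j `|w j ord0|).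
  by move=> a b c h1 h2; have := ler_wpM2l (ltW l_gt0) h2; lra.
have /psumr_eq0P D0' : \sum_i (residual p x i ord0 - residual p z i ord0) ^+ 2 = 0.
  by apply/eqP; rewrite eq_le D0 sumr_ge0// => i _; exact: sqr_ge0.
apply/colP => i; apply/eqP; rewrite -subr_eq0 -sqrf_eq0.
by apply/eqP/D0' => // k _; exact: sqr_ge0.
Qed.

(** One-coordinate perturbations suffice for both optimality conditions below. *)
Lemma lasso_objective_shift p x j t :
  lasso_objective lam p (x + t *: delta_mx j ord0) =
  lasso_objective lam p x - 2 * t * correlation p x j
  + t ^+ 2 * (\sum_i p.2 i j ^+ 2) + ratr lam * (`|x j ord0 + t| - `|x j ord0|).
Proof.
have rs i : residual p (x + t *: delta_mx j ord0) i ord0 =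
    residual p x i ord0 - t * p.2 i j.
  by rewrite /residual mulmxDr -scalemxAr -colE !mxE; lra.
rewrite !lasso_objectiveE.
have -> : \sum_k `|(x + t *: delta_mx j ord0) k ord0| =
    \sum_k `|x k ord0| + (`|x j ord0 + t| - `|x j ord0|).
  rewrite (bigD1 j)//= [in RHS](bigD1 j)//= !mxE !eqxx mulr1.
  rewrite (eq_bigr (fun k => `|x k ord0|)); first lra.
  by move=> k kj; rewrite !mxE (negbTE kj) mulr0 addr0.
rewrite (eq_bigr _ (fun i _ => congr1 (fun u => u ^+ 2) (rs i))).
have -> : \sum_i (residual p x i ord0 - t * p.2 i j) ^+ 2 =
   \sum_i residual p x i ord0 ^+ 2 - 2 * t * correlation p x j
   + t ^+ 2 * (\sum_i p.2 i j ^+ 2).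
  rewrite /correlation !mulr_sumr -sumrB -big_split /=.
  by apply: eq_bigr => i _; ring.
lra.
Qed.

(** Moving entry j by s in the direction of the sign of the correlation raises the penalty by at
    most [ratr lam * s]; the quadratic term is negligible as s tends to 0. *)
Lemma lasso_sol_correlation p x j :
  lasso_sol lam p x -> 2 * `|correlation p x j| <= ratr lam.
Proof.
move=> sx; set g := correlation p x j.
set c := \sum_i p.2 i j ^+ 2.
have c0 : 0 <= c by apply: sumr_ge0 => i _; exact: sqr_ge0.
have key t : 2 * t * g <= t ^+ 2 * c + ratr lam * `|t|.
  have := sx (x + t *: delta_mx j ord0).
  rewrite lasso_objective_shift -/g -/c => h.
  have h2 : `|x j ord0 + t| - `|x j ord0| <= `|t|.
    by rewrite lerBlDl ler_normD.
  have := ler_wpM2l (ltW l_gt0) h2; lra.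
have key2 s : 0 < s -> 2 * `|g| <= s * c + ratr lam.
  move=> s0; have := key (s * Num.sg g).
  rewrite normrM (gtr0_norm s0) exprMn sqr_sg.
  have [->|g0] := eqVneq g 0.
    by rewrite normr0 !mulr0 => _; exact: (addr_ge0 (mulr_ge0 (ltW s0) c0) (ltW l_gt0)).
  rewrite normr_sg g0 !mulr1.
  rewrite (_ : 2 * (s * Num.sg g) * g = s * (2 * `|g|)); last first.
    by rewrite [in RHS]normrEsg; ring.
  rewrite [leRHS](_ : _ = s * (s * c + ratr lam)); last by ring.
  by rewrite ler_pM2l.
rewrite leNgt; apply/negP => lt.
pose d := 2 * `|g| - ratr lam; have d0 : 0 < d by rewrite subr_gt0.
have c1 : 0 < c + 1 by rewrite ltr_wpDl.
(* This step size makes the error term smaller than the excess [d]; the summand 1 keeps the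
   denominator positive when column j is zero. *)
have := key2 (d / (c + 1)) (divr_gt0 d0 c1).
have : d / (c + 1) * c < d.
  by rewrite -mulrA -[ltRHS]mulr1 ltr_pM2l// mulrC ltr_pdivrMr// mul1r ltrDl.
rewrite /d; lra.
Qed.

(** An active entry u can be moved towards 0, to (1 - s) u, which lowers its absolute value by
    exactly the fraction s. Letting s tend to 0 gives the reverse of the previous bound. *)
Lemma lasso_sol_correlation_active p x j :
  lasso_sol lam p x -> x j ord0 != 0 -> 2 * `|correlation p x j| = ratr lam.
Proof.
move=> sx xj0; apply/eqP; rewrite eq_le lasso_sol_correlation//=.
set g := correlation p x j; set u := x j ord0.
set c := \sum_i p.2 i j ^+ 2.
have c0 : 0 <= c by apply: sumr_ge0 => i _; exact: sqr_ge0.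
have u0 : 0 < `|u| by rewrite normr_gt0.
have key s : 0 < s <= 1 -> ratr lam <= 2 * `|g| + s * (`|u| * c).
  move=> /andP[s0 s1].
  have := sx (x + (- s * u) *: delta_mx j ord0).
  rewrite lasso_objective_shift -/g -/c -/u.
  have -> : `|u + - s * u| - `|u| = - s * `|u|.
    rewrite (_ : u + _ = (1 - s) * u); last by ring.
    by rewrite normrM ger0_norm ?subr_ge0//; ring.
  move=> h; have ug : u * g <= `|u| * `|g|.
    by rewrite -normrM ler_norm.
  have uu : u ^+ 2 = `|u| ^+ 2 by rewrite real_normK ?num_real.
  have su : 0 < s * `|u| by rewrite mulr_gt0.
  rewrite -(ler_pM2l su).
  have h1 : s * (u * g) <= s * (`|u| * `|g|) by rewrite ler_pM2l.
  have h2 : 0 <= 2 * (s * (u * g)) + (s * `|u|) ^+ 2 * c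
                 - ratr lam * (s * `|u|).
    move: h; rewrite exprMn uu sqrrN exprMn => h.
    have : 2 * (s * (u * g)) = - (2 * (- s * u) * g) by ring.
    have : ratr lam * (- s * `|u|) = - (ratr lam * (s * `|u|)) by ring.
    lra.
  have e : s * `|u| * (2 * `|g| + s * (`|u| * c)) =
     2 * (s * (`|u| * `|g|)) + (s * `|u|) ^+ 2 * c by ring.
  rewrite e mulrC; lra.
rewrite leNgt; apply/negP => lt.
pose d := ratr lam - 2 * `|g|; have d0 : 0 < d by rewrite subr_gt0.
pose e := `|u| * c; have e0 : 0 <= e by rewrite mulr_ge0// ltW.
have e1 : 0 < e + d by rewrite ltr_wpDl.
have s1 : 0 < d / (e + d) <= 1.
  by rewrite divr_gt0//= ler_pdivrMr// mul1r lerDr.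
have := key _ s1; rewrite -/e.
have : d / (e + d) * e < d.
  by rewrite -mulrA -[ltRHS]mulr1 ltr_pM2l// mulrC ltr_pdivrMr// mul1r ltrDl.
rewrite /d; lra.
Qed.

(** Comparison with the zero vector. The bound is continuous in [p.1] and free of the matrix, hence
    uniform near a given input. *)
Lemma lasso_sol_bounded p x :
  lasso_sol lam p x -> ratr lam * `|x| <= \sum_i p.1 i ord0 ^+ 2.
Proof.
move=> /(_ 0); rewrite !lasso_objectiveE.
rewrite {2}/residual mulmx0 subr0 => h.
have e0 : \sum_j `|(0 : 'cV[R]_N) j ord0| = 0.
  by apply: big1 => j _; rewrite mxE normr0.
move: h; rewrite e0 mulr0 addr0; apply: le_trans.
have x1 : `|x| <= \sum_j `|x j ord0|.
  apply/mx_norm_leP; first exact: sumr_ge0.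
  by move=> i j; rewrite (ord1 j) (bigD1 i)//= lerDl sumr_ge0.
have := ler_wpM2l (ltW l_gt0) x1.
have : 0 <= \sum_i residual p x i ord0 ^+ 2.
  by apply: sumr_ge0 => i _; exact: sqr_ge0.
lra.
Qed.

End Lasso.

(** * Continuity into matrix spaces and compact boxes *)

Lemma continuous_mx (R : realType) (T : topologicalType) (m n : nat)
    (f : T -> 'M[R]_(m, n)) :
  (forall i j, continuous (fun t => f t i j)) -> continuous f.
Proof.
move=> h t; apply/cvgrPdist_lt => e e0.
have : \forall s \near t, forall ij : 'I_m * 'I_n,
    `|f t ij.1 ij.2 - f s ij.1 ij.2| < e.
  apply: filter_forall => ij.
  by have /cvgrPdist_lt := h ij.1 ij.2 t; apply.
apply: filterS => s hs; apply/(mx_norm_ltP _ e0) => i j.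
by rewrite !mxE; exact: (hs (i, j)).
Qed.

Lemma mx_box_compact (R : realType) (m n : nat) (B : R) :
  compact [set A : 'M[R]_(m, n) | forall i j, `|A i j| <= B].
Proof.
have cK : compact [set v : 'rV[R]_(m * n) | forall k, `[- B, B]%classic (v ord0 k)].
  by apply: (@rV_compact _ _ (fun=> `[- B, B]%classic)) => _; exact: segment_compact.
have cv : continuous (@vec_mx R m n).
  apply: continuous_mx => i j.
  rewrite (_ : (fun t => _) = (fun t : 'rV[R]_(m * n) => t ord0 (mxvec_index i j))).
    exact: coord_continuous.
  by apply/funext => t; rewrite mxE.
have -> : [set A : 'M[R]_(m, n) | forall i j, `|A i j| <= B] =
    vec_mx @` [set v : 'rV[R]_(m * n) | forall k, `[- B, B]%classic (v ord0 k)].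
  apply/seteqP; split=> [A hA|A [v hv <-] i j] /=.
    exists (mxvec A); last by rewrite mxvecK.
    by move=> k; case/mxvec_indexP: k => i j; rewrite mxvecE /= in_itv/= -ler_norml.
  by rewrite mxE ler_norml; have := hv (mxvec_index i j); rewrite /= in_itv.
by apply: continuous_compact => //; exact: continuous_subspaceT.
Qed.

Lemma continuous_sum (R : realType) (T : topologicalType) (I : finType)
    (f : I -> T -> R) :
  (forall i, continuous (f i)) -> continuous (fun t => \sum_i f i t).
Proof.
by move=> h; apply: continuous_big => //; exact: add_continuous.
Qed.

(** * Closedness of the solution map *)

Section ClosedProjection.
Context {R : realType} (lam : rat) {m N : nat}.
Hypothesis lam_gt0 : 0 < lam.
Let X := (lasso_input R m N * 'cV[R]_N)%type.

Lemma continuous_vec_entry i : continuous (fun u : X => u.1.1 i ord0).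
Proof.
have c1 : continuous (fun u : X => u.1) by move=> u; exact: cvg_fst.
have c2 : continuous (fun p : lasso_input R m N => p.1).
  by move=> u; exact: cvg_fst.
have c3 := @coord_continuous R m 1 i ord0.
move=> u; exact: (continuous_comp (continuous_comp (c1 u) (c2 u.1)) (c3 u.1.1)).
Qed.

Lemma continuous_mat_entry i j : continuous (fun u : X => u.1.2 i j).
Proof.
have c1 : continuous (fun u : X => u.1) by move=> u; exact: cvg_fst.
have c2 : continuous (fun p : lasso_input R m N => p.2).
  by move=> u; exact: cvg_snd.
have c3 := @coord_continuous R m N i j.
move=> u; exact: (continuous_comp (continuous_comp (c1 u) (c2 u.1)) (c3 u.1.2)).
Qed.

Lemma continuous_sol_entry j : continuous (fun u : X => u.2 j ord0).
Proof.
have c1 : continuous (fun u : X => u.2) by move=> u; exact: cvg_snd.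
have c3 := @coord_continuous R N 1 j ord0.
by move=> u; exact: (continuous_comp (c1 u) (c3 u.2)).
Qed.

Lemma continuous_residual i :
  continuous (fun u : X => residual u.1 u.2 i ord0).
Proof.
rewrite (_ : (fun u => _) = (fun u : X => u.1.1 i ord0 -
    \sum_j u.1.2 i j * u.2 j ord0)); last first.
  by apply/funext => u; rewrite /residual !mxE.
suff c : continuous (fun u : X => \sum_j u.1.2 i j * u.2 j ord0).
  by move=> u; exact: (continuousB (@continuous_vec_entry i u) (c u)).
apply: continuous_sum => j v.
exact: (continuousM (@continuous_mat_entry i j v) (@continuous_sol_entry j v)).
Qed.

Lemma continuous_correlation j :
  continuous (fun u : X => correlation u.1 u.2 j).
Proof.
apply: continuous_sum => i v.
exact: (continuousM (@continuous_mat_entry i j v) (@continuous_residual i v)).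
Qed.

Lemma continuous_lasso_objective :
  continuous (fun u : X => lasso_objective lam u.1 u.2).
Proof.
rewrite (_ : (fun u => _) = (fun u : X =>
   (\sum_i residual u.1 u.2 i ord0 * residual u.1 u.2 i ord0) +
   ratr lam * \sum_j `|u.2 j ord0|)); last first.
  by apply/funext => u; rewrite lasso_objectiveE.
have c1 : continuous (fun u : X =>
    \sum_i residual u.1 u.2 i ord0 * residual u.1 u.2 i ord0).
  apply: continuous_sum => i v.
  exact: (continuousM (@continuous_residual i v) (@continuous_residual i v)).
suff c2 : continuous (fun u : X => \sum_j `|u.2 j ord0|).
  by move=> u; exact: (continuousD (c1 u) (continuousM (cvg_cst _) (c2 u))).
apply: continuous_sum => i v.
exact: (continuous_comp (@continuous_sol_entry i v) (@norm_continuous _ _ _)).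
Qed.

(** An intersection, over all competitors z, of inequalities between continuous functions. *)
Lemma closed_lasso_sol : closed [set u : X | lasso_sol lam u.1 u.2].
Proof.
rewrite (_ : [set u | _] = \bigcap_(z in setT)
  [set u : X | lasso_objective lam u.1 u.2 - lasso_objective lam u.1 z <= 0]).
  apply: closed_bigI => z _.
  have c1 : continuous (fun u : X => (u.1, z) : X).
    move=> u O [[Q1 Q2] /= [n1 n2] sub].
    have : nbhs u ((fun v : X => v.1) @^-1` Q1) by exact: cvg_fst.
    by apply: filterS => v Qv; apply: sub; split=> //=; exact: nbhs_singleton.
  have c2 : continuous (fun u : X => lasso_objective lam u.1 u.2 -
      lasso_objective lam u.1 z).
    move=> u; have c3 := continuous_comp (c1 u) (@continuous_lasso_objective (u.1, z)).
    exact: (continuousB (@continuous_lasso_objective u) c3).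
  by have /continuous_closedP/(_ _ (@closed_le R 0)) := c2.
apply/seteqP; split=> [u h z _|u h z] /=; first by rewrite subr_le0.
by rewrite -subr_le0; exact: h.
Qed.

(* Solutions are locally bounded, so this is a projection along a compact set. *)
Lemma closed_ex_lasso_sol (C : set X) : closed C ->
  closed [set p | exists2 x, lasso_sol lam p x & C (p, x)].
Proof.
move=> cC; rewrite -openC openE => p /= np.
have l_gt0 : 0 < ratr lam :> R by rewrite ltr0q.
pose S (q : lasso_input R m N) := \sum_i q.1 i ord0 * q.1 i ord0.
have cS : continuous S.
  apply: continuous_sum => i q.
  have c1 : {for q, continuous (fun q : lasso_input R m N => q.1 i ord0)}.
    have c2 : {for q, continuous (fun q : lasso_input R m N => q.1)}.
      exact: cvg_fst.
    exact: (continuous_comp c2 (@coord_continuous R m 1 i ord0 q.1)).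
  exact: (continuousM c1 c1).
(* Near p the value of [S] stays below [S p + 1], so all solutions at nearby inputs lie in the box
   of radius [M]. *)
pose M := (S p + 1) / ratr lam.
pose G := [set u : X | lasso_sol lam u.1 u.2] `&` C.
have cG : closed G by apply: closedI => //; exact: closed_lasso_sol.
(* Tube lemma: one neighbourhood of p avoids [G] over the whole compact box. *)
have /compact_near_coveringP/(_ _ (nbhs p) (fun q x => ~ G (q, x)) _) K :=
  @mx_box_compact R N 1 M.
have near1 : \forall q \near p, S q < S p + 1.
  have /cvgr_lt := cS p; apply; by rewrite ltrDl.
have near2 : \forall q \near p,
   [set x : 'cV[R]_N | forall i j, `|x i j| <= M] `<=` [set x | ~ G (q, x)].
  apply: K => x Kx.
  have nG : ~ G (p, x) by move=> [/= s c]; apply: np; exists x.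
  have : nbhs (p, x) (~` G).
    by apply: open_nbhs_nbhs; split => //; rewrite openC.
  move=> [[Q1 Q2] /= [nQ1 nQ2] sub].
  by exists (Q2, Q1) => //= -[x' q'] /= [a b]; exact: (sub (q', x')).
apply: filterS2 near1 near2 => q h1 h2 [x sx Cx].
apply: (h2 x) => //=.
apply/mx_norm_leP.
  by rewrite divr_ge0 ?ltW// ltr_wpDl// sumr_ge0// => i _; rewrite -expr2 sqr_ge0.
rewrite ler_pdivlMr// mulrC; apply: le_trans (lasso_sol_bounded lam_gt0 sx) _.
exact: ltW.
Qed.

End ClosedProjection.

(** * Rescaling a column *)

Section ColumnScaling.
Context {R : realType} (lam : rat) {m N : nat}.
Hypothesis lam_gt0 : 0 < lam.
Implicit Types (p : lasso_input R m N) (x z : 'cV[R]_N) (j : 'I_N) (c : R).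

Definition scale_col j c p : lasso_input R m N :=
  (p.1, \matrix_(i, l) (p.2 i l * (if l == j then c else 1))).

Definition scale_entry j c x : 'cV[R]_N :=
  \col_l (x l ord0 * (if l == j then c else 1)).

Lemma residual_scale_col j c p x :
  residual (scale_col j c p) x = residual p (scale_entry j c x).
Proof.
apply/colP => i; rewrite !mxE; congr (_ - _); apply: eq_bigr => l _.
by rewrite !mxE mulrAC mulrA.
Qed.

(** For positive c, the substitution by [scale_entry] divides the penalty weight of entry j by c;
    the last summand is this change, expressed in the old variable. *)
Lemma lasso_objective_scale_col j c p x : 0 <= c ->
  lasso_objective lam (scale_col j c p) x =
  lasso_objective lam p (scale_entry j c x) + ratr lam * (1 - c) * `|x j ord0|.
Proof.
move=> c0; rewrite !lasso_objectiveE residual_scale_col -addrA; congr (_ + _).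
rewrite -mulrA -mulrDr; congr (_ * _).
rewrite (bigD1 j)//= [in RHS](bigD1 j)//= mxE eqxx normrM (ger0_norm c0).
rewrite [in RHS](eq_bigr (fun l => `|x l ord0|)); first ring.
by move=> l lj; rewrite mxE (negbTE lj) mulr1.
Qed.

Lemma scale_entry_id j c x : x j ord0 = 0 -> scale_entry j c x = x.
Proof.
move=> xj; apply/colP => l; rewrite mxE.
by case: eqP => [->|_]; rewrite ?xj ?mul0r// mulr1.
Qed.

(** If entry j of z were zero, rescaling would not change the objective of z, whereas x with entry j
    divided by c has, after rescaling, a value strictly below that of x at p. *)
Lemma lasso_sol_enlarge_col j c p x z : 1 < c ->
  lasso_sol lam p x -> x j ord0 != 0 ->
  lasso_sol lam (scale_col j c p) z -> z j ord0 != 0.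
Proof.
move=> c1 sx xj sz; apply/eqP => zj.
have c0 : 0 < c by apply: lt_trans c1.
pose v := scale_entry j c^-1 x.
have vx : scale_entry j c v = x.
  apply/colP => l; rewrite !mxE; case: eqP => _; last by rewrite !mulr1.
  by rewrite mulrVK// unitfE gt_eqF.
have vj : 0 < `|v j ord0|.
  by rewrite normr_gt0 mxE eqxx mulf_neq0// invr_eq0 gt_eqF.
have := sz v; rewrite !(lasso_objective_scale_col _ _ _ (ltW c0)) vx scale_entry_id//.
rewrite zj normr0 mulr0 addr0; have := sx z.
have l0 : 0 < ratr lam :> R by rewrite ltr0q.
have cm1 : 0 < c - 1 by rewrite subr_gt0.
have := mulr_gt0 (mulr_gt0 l0 cm1) vj; lra.
Qed.

(** The extra penalty is nonnegative and vanishes at x, so x remains a solution. Its residual is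
    unchanged and its correlation with column j is multiplied by c; uniqueness of the fit carries
    this over to z. *)
Lemma lasso_sol_shrink_col j c p x z : 0 < c < 1 ->
  lasso_sol lam p x -> x j ord0 = 0 ->
  lasso_sol lam (scale_col j c p) z ->
  2 * `|correlation (scale_col j c p) z j| < ratr lam.
Proof.
move=> /andP[c0 c1] sx xj sz.
have l0 : 0 < ratr lam :> R by rewrite ltr0q.
have sx' : lasso_sol lam (scale_col j c p) x.
  move=> w; rewrite !(lasso_objective_scale_col _ _ _ (ltW c0)) scale_entry_id//.
  rewrite xj normr0 mulr0 addr0; apply: le_trans (sx (scale_entry j c w)) _.
  rewrite lerDl mulr_ge0// mulr_ge0 ?subr_ge0; [by []|exact: ltW|exact: ltW].
have -> : correlation (scale_col j c p) z j = c * correlation p x j.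
  rewrite /correlation (lasso_sol_fit_unique lam_gt0 sz sx') residual_scale_col.
  rewrite scale_entry_id// mulr_sumr; apply: eq_bigr => i _.
  by rewrite [in LHS]/= mxE eqxx mulrA; congr (_ * _); rewrite mulrC.
rewrite normrM gtr0_norm// mulrCA.
apply: le_lt_trans (_ : c * ratr lam < _).
  by rewrite ler_pM2l// lasso_sol_correlation.
by rewrite gtr_pMl.
Qed.

Lemma nbhs_ball_inf (P p : lasso_input R m N) (r : R) :
  ball_inf P r p -> nbhs p (ball_inf P r).
Proof.
rewrite /ball_inf /= gt_max => /andP[h1 h2].
have n1 : \forall q \near p, `|q.1 - P.1| < r.
  have c : (fun q : lasso_input R m N => `|q.1 - P.1|) @ p --> `|p.1 - P.1|.
    by apply: cvg_norm; apply: cvgB; [exact: cvg_fst|exact: cvg_cst].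
  by move/cvgr_lt : c; apply.
have n2 : \forall q \near p, `|q.2 - P.2| < r.
  have c : (fun q : lasso_input R m N => `|q.2 - P.2|) @ p --> `|p.2 - P.2|.
    by apply: cvg_norm; apply: cvgB; [exact: cvg_snd|exact: cvg_cst].
  by move/cvgr_lt : c; apply.
by apply: filterS2 n1 n2 => q; rewrite /= gt_max => -> ->.
Qed.

Lemma near_scale_col j p (O : set (lasso_input R m N)) :
  nbhs p O -> \forall c \near (1 : R), O (scale_col j c p).
Proof.
move=> [[Q1 Q2] /= [n1 n2] sub].
have p1 : (\matrix_(i, l) (p.2 i l * (if l == j then 1 else 1))) = p.2.
  by apply/matrixP => i l; rewrite !mxE if_same mulr1.
have cm : continuous (fun c : R =>
    \matrix_(i, l) (p.2 i l * (if l == j then c else 1))).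
  apply: continuous_mx => i l.
  rewrite (_ : (fun t => _) = fun t => p.2 i l * (if l == j then t else 1)).
    case: eqP => _; last exact: cst_continuous.
    by move=> t; apply: cvgM; [exact: cvg_cst|exact: cvg_id].
  by apply/funext => t; rewrite mxE.
have : \forall c \near (1 : R),
    Q2 (\matrix_(i, l) (p.2 i l * (if l == j then c else 1))).
  by apply: cm; rewrite p1.
by apply: filterS => c Qc; apply: sub; split => //=; exact: nbhs_singleton.
Qed.

(* Enlarging a column of the matrix by a factor c lowers the weight of the
   corresponding entry in the l1 norm, so it forces an active entry to stay
   active; shrinking the column keeps an inactive entry strictly inactive. Both
   conclusions persist in a neighbourhood of the perturbed input. *)
Lemma near_excluded_support (P p : lasso_input R m N) (r : R) x
    (S : {set 'I_N}) :
  ball_inf P r p -> lasso_sol lam p x -> supp x <> S ->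
  exists2 q, ball_inf P r q & \forall q' \near q, ~ Xi lam q' S.
Proof.
move=> /nbhs_ball_inf Bp sx xS.
have l0 : 0 < ratr lam :> R by rewrite ltr0q.
have [j jxS] : exists j, (j \in supp x) != (j \in S).
  apply/not_existsP => h; apply: xS; apply/setP => j.
  by apply/eqP; apply/negPn/negP; exact: h.
have /nbhs_ballP[e /= e0 Be] := near_scale_col j Bp.
have [xj|xj] := eqVneq (x j ord0) 0.
  have Sj : j \in S by move: jxS; rewrite inE xj eqxx; case: (j \in S).
  pose c := 1 - Num.min e 1 / 2.
  have h0 : 0 < Num.min e 1 by rewrite lt_min e0 ltr01.
  have h1 : Num.min e 1 <= 1 by rewrite ge_min lexx orbT.
  have h2 : Num.min e 1 <= e by rewrite ge_min lexx.
  have c01 : 0 < c < 1 by rewrite /c; apply/andP; split; lra.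
  exists (scale_col j c p).
    apply: Be; rewrite /ball/= /c opprB addrC subrK gtr0_norm ?divr_gt0//; lra.
  (* Tightness of the correlation is a closed condition, and every active entry satisfies it. *)
  pose C := [set u : lasso_input R m N * 'cV[R]_N |
    ratr lam <= 2 * `|correlation u.1 u.2 j|].
  have cC : closed C.
    have cc : continuous (fun u : lasso_input R m N * 'cV[R]_N =>
        2 * `|correlation u.1 u.2 j|).
      move=> u; have c1 := @continuous_correlation R m N j u.
      exact: (continuousM (cvg_cst _) (continuous_comp c1 (@norm_continuous _ _ _))).
    by have /continuous_closedP/(_ _ (@closed_ge R (ratr lam))) := cc.
  have := closed_ex_lasso_sol lam_gt0 cC; rewrite -openC => oC.
  have : nbhs (scale_col j c p)
      (~` [set p0 | exists2 x0, lasso_sol lam p0 x0 & C (p0, x0)]).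
    apply: open_nbhs_nbhs; split=> // -[z sz].
    by rewrite /C /= leNgt (lasso_sol_shrink_col c01 sx xj sz).
  apply: filterS => q nq [z sz zS]; apply: nq; exists z => //.
  rewrite /C /= (lasso_sol_correlation_active lam_gt0 sz)//.
  by move: Sj; rewrite -zS inE.
have Sj : j \notin S by move: jxS; rewrite inE xj; case: (j \in S).
pose c := 1 + e / 2.
have c1 : 1 < c by rewrite /c ltrDl divr_gt0.
exists (scale_col j c p).
  by apply: Be; rewrite /ball/= /c opprD addrA subrr add0r normrN gtr0_norm ?divr_gt0//; lra.
pose C := [set u : lasso_input R m N * 'cV[R]_N | u.2 j ord0 = 0].
have cC : closed C.
  by have /continuous_closedP/(_ _ (@closed_eq R 0)) := @continuous_sol_entry R m N j.
have := closed_ex_lasso_sol lam_gt0 cC; rewrite -openC => oC.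
have : nbhs (scale_col j c p)
    (~` [set p0 | exists2 x0, lasso_sol lam p0 x0 & C (p0, x0)]).
  apply: open_nbhs_nbhs; split=> // -[z sz].
  by rewrite /C /= => /eqP; apply/negP; exact: (lasso_sol_enlarge_col c1 sx xj sz).
apply: filterS => q nq [z sz zS]; apply: nq; exists z => //.
by move: Sj; rewrite -zS inE negbK => /eqP.
Qed.

End ColumnScaling.

(** * Density of dyadic inputs *)

Section Dyadic.
Context {R : realType}.

Lemma dyadic_dense (x e : R) : 0 < e -> exists2 d, dyadic d & `|x - d| < e.
Proof.
(* Here n exceeds [e^-1] and 2^n exceeds n, so rounding down to a multiple of 2^-n moves x by less
   than e. *)
move=> e0; pose n := (Num.truncn e^-1).+1.
have n2 : 0 < 2 ^+ n :> R by rewrite exprn_gt0.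
have ne : e^-1 < 2 ^+ n.
  apply: lt_le_trans (truncnS_gt _) _.
  by rewrite -natrX ler_nat ltnW// ltn_expl.
exists ((Num.floor (x * 2 ^+ n))%:~R / 2 ^+ n).
  by exists (Num.floor (x * 2 ^+ n)), n.
have /andP[f1 f2] := floor_itv (x * 2 ^+ n).
rewrite -[x in x - _](mulfK (lt0r_neq0 n2)) -mulrBl normrM.
rewrite (gtr0_norm (x := _^-1)) ?invr_gt0// ltr_pdivrMr// ger0_norm ?subr_ge0//.
have e1 : 1 < e * 2 ^+ n by rewrite mulrC -ltr_pdivrMr// mul1r.
by rewrite intrD in f2; lra.
Qed.

Lemma dyadic_mx_dense m n (A : 'M[R]_(m, n)) (O : set 'M[R]_(m, n)) :
  nbhs A O -> exists2 D, O D & forall i j, dyadic (D i j).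
Proof.
move=> /nbhs_ballP[e /= e0 Oe].
have h i j := dyadic_dense (A i j) e0.
exists (\matrix_(i, j) s2val (cid2 (h i j))).
  apply: Oe; rewrite -ball_normE /=; apply/mx_norm_ltP => // i j.
  by rewrite !mxE; case: cid2.
by move=> i j; rewrite mxE; case: cid2.
Qed.

Lemma dyadic_input_dense m N (p : lasso_input R m N)
    (O : set (lasso_input R m N)) :
  nbhs p O -> exists q : lasso_input R m N,
    [/\ O q, forall i, dyadic (q.1 i ord0) & forall i j, dyadic (q.2 i j)].
Proof.
move=> [[Q1 Q2] /= [/dyadic_mx_dense[y Q1y dy] /dyadic_mx_dense[A Q2A dA]] sub].
by exists (y, A); split => //; exact: sub.
Qed.

End Dyadic.

(** * Null sets *)

Section NullSets.
Context {R : realType} {m N : nat}.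
Hypothesis m_gt0 : (0 < m)%N.
Notation input := (lasso_input R m N).
Notation axis := ('I_m + 'I_m * 'I_N)%type.
Implicit Types (p q a c : input) (k : axis) (S : set input).

(** With one index type for all coordinates, a box volume is a single product and any axis can be
    singled out. *)
Definition input_entry p k : R :=
  match k with inl i => p.1 i ord0 | inr ij => p.2 ij.1 ij.2 end.

Definition input_of_entries (f : axis -> R) : input :=
  (\col_i f (inl i), \matrix_(i, j) f (inr (i, j))).

Lemma input_of_entriesK f k : input_entry (input_of_entries f) k = f k.
Proof. by case: k => [i|[i j]]; rewrite /= mxE. Qed.

Lemma input_entry_inj p q : input_entry p =1 input_entry q -> p = q.
Proof.
case: p q => [y A] [z B] h; congr (_, _).
  by apply/colP => i; exact: (h (inl i)).
by apply/matrixP => i j; exact: (h (inr (i, j))).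
Qed.

Lemma box_volumeE a c :
  box_volume a c = \prod_k (input_entry c k - input_entry a k).
Proof. by rewrite big_sumType /box_volume /= pair_bigA. Qed.

Lemma le_coordP a c :
  le_coord a c <-> forall k, input_entry a k <= input_entry c k.
Proof.
split=> [[h1 h2] [i|[i j]]|h]; [exact: h1|exact: h2|].
by split=> [i|i j]; [exact: (h (inl i))|exact: (h (inr (i, j)))].
Qed.

Lemma box_volume_ge0 a c : le_coord a c -> 0 <= box_volume a c.
Proof.
by move/le_coordP => h; rewrite box_volumeE prodr_ge0// => k _; rewrite subr_ge0.
Qed.

(** A positive [m] supplies an axis; over no axes the empty product would be 1. *)
Lemma box_volume_refl a : box_volume a a = 0.
Proof.
by rewrite box_volumeE (bigD1 (inl (Ordinal m_gt0)))//= subrr mul0r.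
Qed.

Lemma lebesgue_outer_ge0 S : (0 <= lebesgue_outer S)%E.
Proof.
apply: le_ereal_inf_tmp => _ [a [c [ac _ ->]]].
by apply: nneseries_ge0 => n _ _; rewrite lee_fin box_volume_ge0.
Qed.

Lemma lebesgue_nullP S : lebesgue_null S <-> forall e : R, 0 < e ->
  exists a c : nat -> input, [/\ forall n, le_coord (a n) (c n),
    S `<=` \bigcup_n box (a n) (c n) &
    (\sum_(0 <= n <oo) (box_volume (a n) (c n))%:E <= e%:E)%E].
Proof.
split=> [S0 e e0|h].
  have : (lebesgue_outer S < e%:E)%E by rewrite S0 lte_fin.
  move=> /ereal_inf_lt[_ [a [c [ac Sac ->]]] /ltW lte].
  by exists a, c.
apply/eqP; rewrite eq_le lebesgue_outer_ge0 andbT.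
apply/lee_addgt0Pr => e e0; rewrite add0e.
have [a [c [ac Sac le]]] := h _ e0.
by apply: le_trans le; apply: ereal_inf_lbound; exists a, c.
Qed.

Lemma lebesgue_null_sub S T : S `<=` T -> lebesgue_null T -> lebesgue_null S.
Proof.
move=> ST /lebesgue_nullP h; apply/lebesgue_nullP => e /h[a [c [ac Tac le]]].
by exists a, c; split => //; exact: subset_trans Tac.
Qed.

(** The finite cover is padded to a sequence by the degenerate box at the origin, of volume 0. *)
Lemma lebesgue_null_finite_cover S :
  (forall e : R, 0 < e -> exists (J : finType) (a c : J -> input),
    [/\ forall j, le_coord (a j) (c j), S `<=` \bigcup_j box (a j) (c j) &
        \sum_j box_volume (a j) (c j) <= e]) ->
  lebesgue_null S.
Proof.
move=> h; apply/lebesgue_nullP => e /h[J [a [c [ac Sac le]]]].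
pose s := [seq (a j, c j) | j <- enum J].
pose b n := nth (0 : input, 0 : input) s n.
have bs n : (size s <= n)%N -> b n = (0, 0) by exact: nth_default.
have bj n : (n < size s)%N -> exists j, b n = (a j, c j).
  by move=> ns; have /mapP[j _ E] := mem_nth (0 : input, 0 : input) ns; exists j.
exists (fun n => (b n).1), (fun n => (b n).2); split.
- move=> n; have [/bs ->|/bj[j ->]] := leqP (size s) n; last exact: ac.
  by split.
- move=> p /Sac[j _ pj]; exists (index (a j, c j) s) => //.
  have sj : (a j, c j) \in s by apply/mapP; exists j; rewrite // mem_enum.
  by rewrite /b nth_index.
rewrite (nneseries_split 0 (size s)); last first.
  move=> n _; rewrite lee_fin; have [/bs ->|/bj[j ->]] := leqP (size s) n.
    by rewrite box_volume_refl.
  by apply: box_volume_ge0; exact: ac.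
rewrite add0n [X in (_ + X)%E]eseries0 ?adde0; last first.
  by move=> n /bs -> _; rewrite box_volume_refl.
rewrite sumEFin lee_fin; apply: le_trans le.
rewrite -(big_nth (0 : input, 0 : input) xpredT (fun ac => box_volume ac.1 ac.2)).
by rewrite big_map big_enum.
Qed.

(** The n-th set gets a cover of volume at most e / 2^(n+1), and the double family of boxes is
    listed along a bijection of [nat] with pairs. *)
Lemma lebesgue_null_bigcup (K : nat -> set input) :
  (forall n, lebesgue_null (K n)) -> lebesgue_null (\bigcup_n K n).
Proof.
move=> h; apply/lebesgue_nullP => e e0.
have {}h n : exists ac : (nat -> input) * (nat -> input),
    [/\ forall i, le_coord (ac.1 i) (ac.2 i),
      K n `<=` \bigcup_i box (ac.1 i) (ac.2 i) &
    (\sum_(0 <= i <oo) (box_volume (ac.1 i) (ac.2 i))%:E <=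
      (e / (2 ^ n.+1)%:R)%:E)%E].
  have e1 : 0 < e / (2 ^ n.+1)%:R by rewrite divr_gt0// ltr0n expn_gt0.
  have /lebesgue_nullP/(_ _ e1)[a [c ac]] := h n.
  by exists (a, c).
have {h} [f /all_and3[ac Kac le]] := choice h.
have /ppcard_eqP[g] : ([set: nat] #= [set: nat * nat])%card.
  by rewrite card_eq_sym; exact: card_nat2.
pose v n i := (box_volume ((f n).1 i) ((f n).2 i))%:E.
have v0 n i : (0 <= v n i)%E by rewrite lee_fin box_volume_ge0.
exists (fun l => (f (g l).1).1 (g l).2), (fun l => (f (g l).1).2 (g l).2).
split=> [l//|p [n _ /Kac[i _ pi]]|].
  have [l _ gl] : (g @` [set: nat]) (n, i) by rewrite image_eq.
  by exists l => //; rewrite gl.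
rewrite (_ : limn _ = \sum_(n <oo) \sum_(i <oo) v n i)%E; last first.
  transitivity (\esum_(l in [set: nat] `*` [set: nat]) v l.1 l.2)%E; last first.
    rewrite (_ : _ `*` _ = setT `*`` (fun=> setT)); last by apply/seteqP; split.
    rewrite -(@esum_esum _ _ _ _ _ v)// [in RHS]nneseries_esumT; last first.
      by move=> n; exact: nneseries_ge0.
    by apply: eq_esum => i _; rewrite nneseries_esumT.
  rewrite (reindex_esum [set: nat] _ g)//; last first.
    have := @bijTT _ _ g.
    by rewrite -setTT_bijective/= -[in X in set_bij _ X _ -> _](@setXTT nat nat).
  by rewrite nneseries_esumT// => l; exact: v0.
apply: le_trans (epsilon_trick0 xpredT (ltW e0)).
by apply: lee_nneseries => n *; [exact: nneseries_ge0|exact: le].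
Qed.

Lemma lebesgue_null_countable_bigcup (T : countType) (K : T -> set input) :
  (forall t, lebesgue_null (K t)) -> lebesgue_null (\bigcup_t K t).
Proof.
move=> h; pose K' n := if unpickle n is Some t then K t else set0.
apply: (@lebesgue_null_sub _ (\bigcup_n K' n)).
  by move=> p [t _ Kp]; exists (pickle t) => //; rewrite /K' pickleK.
apply: lebesgue_null_bigcup => n; rewrite /K'; case: unpickle => // {n}.
(* Numbers coding no element contribute the empty set, covered by the empty family of boxes. *)
apply: lebesgue_null_finite_cover => e e0.
exists void, (fun=> 0), (fun=> 0).
split=> [[]|//|]; rewrite big1 => [|[]]; exact: ltW.
Qed.

Lemma continuous_input_entry k : continuous (fun p => input_entry p k).
Proof.
move=> p; case: k => [i|[i j]] /=.
  have c : {for p, continuous (fun q : input => q.1)} by exact: cvg_fst.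
  exact: (continuous_comp c (@coord_continuous R m 1 i ord0 p.1)).
have c : {for p, continuous (fun q : input => q.2)} by exact: cvg_snd.
exact: (continuous_comp c (@coord_continuous R m N i j p.2)).
Qed.

Lemma bounded_closed_input_compact S (M : R) : closed S ->
  (forall p, S p -> forall k, `|input_entry p k| <= M) -> compact S.
Proof.
move=> cS bS.
apply: (subclosed_compact cS (compact_setX (@mx_box_compact R m 1 M)
  (@mx_box_compact R m N M))) => p /bS h; split=> i j.
  by rewrite (ord1 j); exact: (h (inl i)).
exact: (h (inr (i, j))).
Qed.

(* If a compact set meets every line parallel to the axis k0 in at most one
   point, then it meets every thin enough column along k0 in a short piece. *)
Lemma thin_compact_columns S k0 (eta : R) : compact S ->
  (forall p q, S p -> S q ->
    (forall k, k != k0 -> input_entry p k = input_entry q k) -> p = q) -> 0 < eta ->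
  exists2 h : R, 0 < h & forall p q, S p -> S q ->
    (forall k, k != k0 -> `|input_entry p k - input_entry q k| <= h) ->
    `|input_entry p k0 - input_entry q k0| <= eta.
Proof.
move=> cS thin eta0.
have cdist k : continuous (fun u : input * input => `|input_entry u.1 k - input_entry u.2 k|).
  move=> u.
  have c1 : {for u, continuous (fun u : input * input => u.1)} by exact: cvg_fst.
  have c2 : {for u, continuous (fun u : input * input => u.2)} by exact: cvg_snd.
  have c3 := continuous_comp c1 (@continuous_input_entry k u.1).
  have c4 := continuous_comp c2 (@continuous_input_entry k u.2).
  exact: (continuous_comp (continuousB c3 c4) (@norm_continuous _ _ _)).
have /compact_near_coveringP cov := compact_setX cS cS.
have near_h : \forall h \near 0^'+, S `*` S `<=` [set u |
    (forall k, k != k0 -> `|input_entry u.1 k - input_entry u.2 k| <= h) ->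
    `|input_entry u.1 k0 - input_entry u.2 k0| <= eta].
  apply: (cov R (0^'+) (fun h u =>
    (forall k, k != k0 -> `|input_entry u.1 k - input_entry u.2 k| <= h) ->
    `|input_entry u.1 k0 - input_entry u.2 k0| <= eta)) => -[p q] [/= Sp Sq].
  (* Near a pair agreeing off [k0], hence equal, the conclusion holds. Near a pair differing on
     another axis, the premise fails once h is below half that difference. *)
  have [pq|/existsNP[k /not_implyP[kk0 pqk]]] :=
      pselect (forall k, k != k0 -> input_entry p k = input_entry q k).
    have <- := thin _ _ Sp Sq pq.
    have nb : \forall u \near (p, p), `|input_entry u.1 k0 - input_entry u.2 k0| < eta.
      have /cvgr_lt := cdist k0 (p, p); apply.
      by rewrite /= subrr normr0.
    exists ([set u | `|input_entry u.1 k0 - input_entry u.2 k0| < eta], setT) => /=.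
      by split=> //; exact: filterT.
    by move=> [u h] [/= /ltW].
  pose d := `|input_entry p k - input_entry q k| / 2.
  have d0 : 0 < `|input_entry p k - input_entry q k|.
    by rewrite normr_gt0 subr_eq0; exact/eqP.
  have nb : \forall u \near (p, q), d < `|input_entry u.1 k - input_entry u.2 k|.
    have /cvgr_gt := cdist k (p, q); apply.
    by rewrite /= /d; lra.
  exists ([set u | d < `|input_entry u.1 k - input_entry u.2 k|], [set h | h < d]) => /=.
    by split=> //; apply: nbhs_right_lt; rewrite divr_gt0.
  move=> [u h] [/= du hd] /(_ k kk0) le.
  by have := lt_le_trans du (le_trans le (ltW hd)); rewrite ltxx.
have [h [h0 hS]] := filter_ex (filterI (nbhs_right_gt (0 : R)) near_h).
by exists h => // p q Sp Sq; exact: (hS (p, q)).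
Qed.

Lemma grid_cell (n : nat) (M w x : R) : 0 < w -> w *+ n.+1 = 2 * M ->
  `|x| <= M -> exists t : 'I_n.+1, - M + w *+ t <= x <= - M + w *+ t.+1.
Proof.
move=> w0 wn; rewrite ler_norml => /andP[x1 x2].
(* The last cell is closed, so it also takes the right end of the interval. *)
have [xM|xM] := leP (- M + w *+ n) x.
  exists ord_max; rewrite xM /=; rewrite wn; lra.
have y0 : 0 <= (x + M) / w by rewrite divr_ge0 ?(ltW w0)//; lra.
have /andP[t1 t2] := truncn_itv y0.
have t1' : w *+ Num.truncn ((x + M) / w) <= x + M.
  by rewrite -mulr_natr mulrC -ler_pdivlMr.
have t2' : x + M < w *+ (Num.truncn ((x + M) / w)).+1.
  by rewrite -[ltRHS]mulr_natr mulrC -ltr_pdivrMr.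
have tn : (Num.truncn ((x + M) / w) < n.+1)%N.
  rewrite ltnS -(ler_nat R) -(ler_pM2l w0) !mulr_natr; lra.
by exists (Ordinal tn) => /=; lra.
Qed.

(** The cube is cut into thin columns along [k0]. In each of them the set lies in a short box, and
    the cross-sections have bounded total measure. *)
Lemma thin_null S k0 (M : R) : closed S ->
  (forall p, S p -> forall k, `|input_entry p k| <= M) ->
  (forall p q, S p -> S q ->
    (forall k, k != k0 -> input_entry p k = input_entry q k) -> p = q) ->
  lebesgue_null S.
Proof.
move=> cS bS thin.
wlog M0 : M bS / 0 < M.
  move=> W; apply: (W (Num.max M 1)); last by rewrite lt_max ltr01 orbT.
  by move=> p /bS h k; rewrite le_max h.
have coS := bounded_closed_input_compact cS bS.
apply: lebesgue_null_finite_cover => e e0.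
pose C := \prod_(k | k != k0) (2 * M).
have C0 : 0 < C by apply: prodr_gt0 => k _; rewrite mulr_gt0.
(* The cross-sections have total measure [C] and each box has height [2 * eta], so the volumes add
   up to e. *)
pose eta := e / (2 * C).
have eta0 : 0 < eta by rewrite divr_gt0// mulr_gt0.
have [h h0 col] := thin_compact_columns coS thin eta0.
pose n := Num.truncn (2 * M / h).
pose w := 2 * M / n.+1%:R.
have w0 : 0 < w by rewrite divr_gt0// mulr_gt0.
have wn : w *+ n.+1 = 2 * M by rewrite -mulr_natr mulrVK// unitfE pnatr_eq0.
have wh : w <= h.
  by rewrite ler_pdivrMr// [leRHS]mulrC -ler_pdivrMr// ltW ?truncnS_gt.
pose Col (z : {ffun axis -> 'I_n.+1}) p := S p /\ forall k, k != k0 ->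
  - M + w *+ z k <= input_entry p k <= - M + w *+ (z k).+1.
(* A column meeting [S] is centred at one of its points of [S]; for the others 0 serves as a
   default. *)
have cen z : exists c0 : R, forall p, Col z p -> `|input_entry p k0 - c0| <= eta.
  have [[q [Sq zq]]|none] := pselect (exists q, Col z q); last first.
    by exists 0 => p Cp; case: none; exists p.
  exists (input_entry q k0) => p [Sp zp]; apply: col => // k kk0.
  have /andP[p1 p2] := zp _ kk0; have /andP[q1 q2] := zq _ kk0.
  apply: le_trans wh; rewrite ler_norml; rewrite !mulrSr in p2 q2.
  by apply/andP; split; lra.
have [c0 cc0] := choice cen.
(* Grid indices also run over the axis [k0], so that sum and product can be exchanged. Only index 0
   there carries a box of positive height; the others are flat, so each column counts once. *)
pose rad (t : 'I_n.+1) : R := if t == ord0 then eta else 0.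
pose lo z := input_of_entries (fun k =>
  if k == k0 then c0 z - rad (z k) else - M + w *+ z k).
pose hi z := input_of_entries (fun k =>
  if k == k0 then c0 z + rad (z k) else - M + w *+ (z k).+1).
have rad0 t : 0 <= rad t by rewrite /rad; case: ifP => // _; exact: ltW.
exists {ffun axis -> 'I_n.+1}, lo, hi; split.
- move=> z; apply/le_coordP => k; rewrite !input_of_entriesK; case: ifP => _.
    by have := rad0 (z k); lra.
  by rewrite mulrSr lerD2l lerDl ltW.
- move=> p Sp.
  have cell k := grid_cell w0 wn (bS _ Sp k).
  have [t tP] := choice cell.
  pose z := [ffun k => if k == k0 then ord0 else t k].
  have Cz : Col z p by split=> // k kk0; rewrite ffunE (negbTE kk0).
  exists z => //; split; apply/le_coordP => k; rewrite input_of_entriesK ffunE;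
    case: (eqVneq k k0) => [->|kk0].
  + by rewrite /rad eqxx; have := cc0 _ _ Cz; rewrite ler_norml => /andP[]; lra.
  + by have /andP[] := tP k.
  + by rewrite /rad eqxx; have := cc0 _ _ Cz; rewrite ler_norml => /andP[]; lra.
  + by have /andP[] := tP k.
pose F k (t : 'I_n.+1) := if k == k0 then 2 * rad t else w.
rewrite (eq_bigr (fun z : {ffun axis -> 'I_n.+1} => \prod_k F k (z k))); last first.
  move=> z _; rewrite box_volumeE; apply: eq_bigr => k _.
  by rewrite !input_of_entriesK /F; case: ifP => _; rewrite ?mulrSr; lra.
(* The total volume becomes a product over the axes of sums over slices: [2 * eta] on [k0] and
   [2 * M] on every other axis. *)
rewrite -bigA_distr_bigA (bigD1 k0)//=.
have -> : \prod_(k | k != k0) \sum_t F k t = C.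
  by apply: eq_bigr => k kk0; rewrite /F (negbTE kk0) sumr_const card_ord.
rewrite (bigD1 ord0)//= big1 => [|t t0]; last by rewrite /F eqxx /rad (negbTE t0) mulr0.
rewrite /F eqxx /rad eqxx addr0 /eta le_eqVlt; apply/orP; left; apply/eqP.
by field; rewrite gt_eqF.
Qed.

End NullSets.

(** * Inputs with solutions of two different supports *)

Section TwoSupports.
Context {R : realType} (lam : rat) {m N : nat}.
Hypotheses (lam_gt0 : 0 < lam) (m_gt0 : (0 < m)%N).
Notation input := (lasso_input R m N).
Implicit Types (p q : input) (x z : 'cV[R]_N).

Lemma residual_off_column j p q z : p.1 = q.1 ->
  (forall i l, l != j -> p.2 i l = q.2 i l) -> z j ord0 = 0 ->
  residual p z = residual q z.
Proof.
move=> e1 e2 zj; rewrite /residual e1; congr (_ - _); apply/colP => i.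
rewrite !mxE; apply: eq_bigr => l _.
by have [->|lj] := eqVneq l j; [rewrite zj !mulr0|rewrite e2].
Qed.

(** The objectives at p and q coincide on vectors with entry j zero, so z also minimises at p, where
    the fit is unique. *)
Lemma lasso_sol_off_column j p q x z : p.1 = q.1 ->
  (forall i l, l != j -> p.2 i l = q.2 i l) ->
  lasso_sol lam p x -> lasso_sol lam q z -> x j ord0 = 0 -> z j ord0 = 0 ->
  residual p x = residual q z.
Proof.
move=> e1 e2 sx sz xj zj.
have oE (y : 'cV[R]_N) : y j ord0 = 0 ->
      lasso_objective lam p y = lasso_objective lam q y.
  by move=> yj; rewrite !lasso_objectiveE (residual_off_column e1 e2 yj).
rewrite -(residual_off_column e1 e2 zj); apply: (lasso_sol_fit_unique lam_gt0 sx).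
move=> y; rewrite (oE _ zj); apply: le_trans (sz x) _.
by rewrite -(oE _ xj); exact: sx.
Qed.

(* The lower bound on one entry of the residual is there to make this set
   closed. *)
Definition tight_inputs (M : R) (j : 'I_N) (t : nat * 'I_m * bool) : set input :=
  [set p | forall k, `|input_entry p k| <= M] `&`
  [set p | exists2 x, lasso_sol lam p x & [/\ x j ord0 = 0,
    t.1.1.+1%:R^-1 <= `|residual p x t.1.2 ord0| &
    2 * correlation p x j = (-1) ^+ t.2 * ratr lam]].

Lemma tight_inputs_closed M j t : closed (tight_inputs M j t).
Proof.
apply: closedI.
  rewrite (_ : mkset _ = \bigcap_(k in setT) [set p | `|input_entry p k| <= M]).
    apply: closed_bigI => k _.
    have c : continuous (fun p : input => `|input_entry p k|).
      move=> p.
      exact: (continuous_comp (@continuous_input_entry R m N k p) (@norm_continuous _ _ _)).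
    by have /continuous_closedP/(_ _ (@closed_le R M)) := c.
  by apply/seteqP; split=> [p h k _|p h k]; exact: h.
pose C := [set u : input * 'cV[R]_N | u.2 j ord0 = 0] `&`
  ([set u | t.1.1.+1%:R^-1 <= `|residual u.1 u.2 t.1.2 ord0|] `&`
   [set u | 2 * correlation u.1 u.2 j = (-1) ^+ t.2 * ratr lam]).
have cC : closed C.
  apply: closedI.
    by have /continuous_closedP/(_ _ (@closed_eq R 0)) :=
      @continuous_sol_entry R m N j.
  apply: closedI.
    have c : continuous (fun u : input * 'cV[R]_N =>
        `|residual u.1 u.2 t.1.2 ord0|).
      move=> u; have c1 := @continuous_residual R m N t.1.2 u.
      exact: (continuous_comp c1 (@norm_continuous _ _ _)).
    by have /continuous_closedP/(_ _ (@closed_ge R t.1.1.+1%:R^-1)) := c.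
  have c : continuous (fun u : input * 'cV[R]_N => 2 * correlation u.1 u.2 j).
    move=> u; exact: (continuousM (cvg_cst _) (@continuous_correlation R m N j u)).
  by have /continuous_closedP/(_ _ (@closed_eq R ((-1) ^+ t.2 * ratr lam))) := c.
rewrite (_ : mkset _ = [set p | exists2 x, lasso_sol lam p x & C (p, x)]).
  exact: closed_ex_lasso_sol.
apply/seteqP; split=> p [x sx].
  by case=> *; exists x.
by case=> ? [? ?]; exists x.
Qed.

(* With x_j = 0 the residual does not depend on column j, so the tightness
   condition on the correlation is a nontrivial linear equation in column j. *)
Lemma tight_inputs_null M j t : lebesgue_null (tight_inputs M j t).
Proof.
case: t => [[n i0] s]; pose k0 : 'I_m + 'I_m * 'I_N := inr (i0, j).
apply: (@thin_null R m N m_gt0 _ k0 M (@tight_inputs_closed M j _)).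
  by move=> p [].
move=> p q [_ [x sx [xj xr xc]]] [_ [z sz [zj zr zc]]] pq.
have e1 : p.1 = q.1 by apply/colP => i; exact: (pq (inl i)).
have e2 i l : l != j -> p.2 i l = q.2 i l.
  by move=> lj; apply: (pq (inr (i, l))); apply: contra lj => /eqP[_ ->].
have rE := lasso_sol_off_column e1 e2 sx sz xj zj.
have cE : correlation p x j = correlation q z j.
  by have := etrans xc (esym zc); lra.
have pq0 : p.2 i0 j = q.2 i0 j.
  have r0 : residual p x i0 ord0 != 0.
    by rewrite -normr_gt0; apply: lt_le_trans xr; rewrite invr_gt0 ltr0n.
  apply: (mulIf r0); move: cE; rewrite /correlation -rE.
  rewrite (bigD1 i0)//= [in RHS](bigD1 i0)//=.
  rewrite (eq_bigr (fun i => q.2 i j * residual p x i ord0)); first exact: addIr.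
  move=> i ii0; congr (_ * _); apply: (pq (inr (i, j))).
  by apply: contra ii0 => /eqP[->].
apply: input_entry_inj => k; have [->|kk0] := eqVneq k k0; first exact: pq0.
exact: pq.
Qed.

(** The two solutions share their residual, so the active entry of z makes the correlation of x
    tight. It is nonzero because [lam] is positive, hence some residual entry is nonzero and gives
    the lower bound; the boolean records the sign. *)
Lemma tight_inputs_active M j p x z : (forall k, `|input_entry p k| <= M) ->
  lasso_sol lam p x -> lasso_sol lam p z -> x j ord0 = 0 -> z j ord0 != 0 ->
  (\bigcup_t tight_inputs M j t) p.
Proof.
move=> bp sx sz xj zj.
have l0 : 0 < ratr lam :> R by rewrite ltr0q.
have rE := lasso_sol_fit_unique lam_gt0 sx sz.
have c0 := lasso_sol_correlation_active lam_gt0 sz zj.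
rewrite /correlation -rE -/(correlation p x j) in c0.
have [i ri] : exists i, residual p x i ord0 != 0.
  apply/not_existsP => h; move: l0; rewrite -c0 /correlation big1.
    by rewrite normr0 mulr0 ltxx.
  by move=> i _; have /negP/negPn/eqP -> := h i; rewrite mulr0.
pose n := Num.truncn (`|residual p x i ord0|^-1).
exists (n, i, correlation p x j < 0) => //; split=> //; exists x => //; split=> //=.
  rewrite -[leRHS]invrK lef_pV2 ?posrE ?ltr0n ?invr_gt0 ?normr_gt0//.
  by rewrite ltW// truncnS_gt.
rewrite -c0 mulrCA; congr (_ * _).
by rewrite {1}[correlation p x j]numEsign.
Qed.

(** An index lying in only one of S and T is inactive in one solution and active in the other. *)
Lemma two_supports_null (M : R) (S T : {set 'I_N}) : S <> T ->
  lebesgue_null [set p : input |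
    [/\ forall k, `|input_entry p k| <= M, Xi lam p S & Xi lam p T]].
Proof.
move=> ST.
have [j jST] : exists j, (j \in S) != (j \in T).
  apply/not_existsP => h; apply: ST; apply/setP => j.
  by apply/eqP; apply/negPn/negP; exact: h.
apply: (@lebesgue_null_sub _ _ _ _ (\bigcup_t tight_inputs M j t)).
  move=> p [bp [x sx xS] [z sz zT]]; move: jST; rewrite -xS -zT !inE.
  have [xj|xj] := eqVneq (x j ord0) 0; have [zj|zj] := eqVneq (z j ord0) 0 => // _.
    exact: (tight_inputs_active bp sx sz xj zj).
  exact: (tight_inputs_active bp sz sx zj xj).
by apply: lebesgue_null_countable_bigcup => // t; exact: tight_inputs_null.
Qed.

End TwoSupports.

(** * Finite precision algorithms *)

Section FinitePrecision.
Context {R : realType} {m N : nat}.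
Notation input := (lasso_input R m N).
Implicit Types (p q P : input).

Lemma ball_infP P r p : ball_inf P r p <->
  `|p.1 - P.1| < r /\ `|p.2 - P.2| < r.
Proof. by rewrite /ball_inf /= gt_max; split=> [/andP|[-> ->]]. Qed.

Lemma ball_inf_entry P (r : R) p : ball_inf P r p ->
  forall k, `|input_entry p k| <= `|P.1| + `|P.2| + r.
Proof.
move=> /ball_infP[/ltW p1 /ltW p2] k.
have n1 : `|p.1| <= `|P.1| + `|P.2| + r.
  rewrite -[p.1](subrK P.1); apply: le_trans (ler_normD _ _) _.
  by have := normr_ge0 P.2; lra.
have n2 : `|p.2| <= `|P.1| + `|P.2| + r.
  rewrite -[p.2](subrK P.2); apply: le_trans (ler_normD _ _) _.
  by have := normr_ge0 P.1; lra.
have M0 : 0 <= `|P.1| + `|P.2| + r := le_trans (normr_ge0 _) n1.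
case: k => [i|[i j]] /=; first by move/(mx_norm_leP _ M0) : n1; exact.
by move/(mx_norm_leP _ M0) : n2; exact.
Qed.

(* The sequence that starts with k copies of q and continues with p is
   admissible for p and indistinguishable from the constant sequence q. *)
Lemma finite_precision_confuses (Omega : set input)
    (Gamma : general_algorithm Omega) k P (r : R) p q : finite_precision Gamma k -> r < 2 ^- k.+1 ->
  ball_inf P r `<=` Omega -> ball_inf P r p -> ball_inf P r q ->
  exists s,
    [/\ delta1_info Omega s, corresponds s p & Gamma s = Gamma (fun=> q)].
Proof.
move=> fp rk PO Pp Pq.
(* Position n holds the term of index n+1, so q fills the indices 1 to k. There the tolerance is at
   least 2^-k, while q is within 2r of p. *)
pose s n := if (n < k)%N then q else p.
have rk2 : r + r <= 2 ^- k.
  move: rk; rewrite exprS invfM => rk; lra.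
have sp : corresponds s p.
  move=> n; rewrite /s; case: ifPn => nk; last first.
    by rewrite !subrr !normr0 invr_ge0 exprn_ge0.
  have le : r + r <= 2 ^- n.+1.
    apply: le_trans rk2 _; rewrite lef_pV2 ?posrE ?exprn_gt0//.
    by rewrite ler_eXn2l// ltr1n.
  move/ball_infP : Pp => [/ltW p1 /ltW p2]; move/ball_infP : Pq => [/ltW q1 /ltW q2].
  split; apply: le_trans le; [rewrite -(subrKA P.1)|rewrite -(subrKA P.2)];
    apply: le_trans (ler_normD _ _) _; apply: lerD => //; by rewrite distrC.
have ds : delta1_info Omega s by exists p => //; exact: PO.
have dq : delta1_info Omega (fun=> q).
  by exists q; [exact: PO|move=> n; rewrite !subrr !normr0 invr_ge0 exprn_ge0].
(* Determinacy starts from the constant sequence: what is read there has index at most k, where both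
   sequences agree. *)
exists s; split=> //; apply: run_determined => // f ff.
have fk : (evaluation_index f <= k)%N.
  rewrite -(ler_nat R) -lee_fin; apply: le_trans (fp _ dq).
  by apply: ereal_sup_ubound; exists f.
by case: f ff fk => n ff /= nk; rewrite /s nk.
Qed.

End FinitePrecision.

(** * From the condition number to failure *)

Lemma cond_UL_stsp (R : realType) (lam : rat) (m N : nat)
    (p : lasso_input R m N) (alpha : R) :
  cond_UL lam p = alpha%:E -> 0 < alpha^-1 -> stsp lam p = alpha^-1%:E.
Proof.
rewrite /cond_UL; case: eqP => // _ h a0.
(* The value 0 of [alpha] is excluded because the real inverse of 0 is 0, against [0 < alpha^-1]. *)
by rewrite -[LHS]inveK h inver; case: eqP => // a00; rewrite a00 invr0 ltxx in a0.
Qed.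

Unset Implicit Arguments.
Set Strict Implicit.
Set Printing Implicit Defensive.

Theorem theorem2p3 (R : realType) (lam : rat) (m N k : nat)
    (hlam : 0 < lam) (hm : (0 < m)%N) (hN : (0 < N)%N) (hk : (0 < k)%N)
    (Omega : set (lasso_input R m N)) (hOmega : open Omega)
    (Gamma1 Gamma2 : general_algorithm Omega)
    (hGamma1 : finite_precision Gamma1 k)
    (hGamma2 : finite_precision Gamma2 k)
    (hcorrect : correct_on_exact lam Gamma1)
    (b : 'cV[R]_m) (U : 'M[R]_(m, N)) (alpha : R)
    (hcond : cond_UL lam (b, U) = alpha%:E)
    (halpha : 0 < alpha^-1 < 2 ^- k.+1)
    (r : R) (hr : alpha^-1 < r < 2 ^- k.+1)
    (hball : ball_inf (b, U) r `<=` Omega) :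
  (exists F : set (lasso_input R m N),
    [/\ fails_on lam Gamma1 F,
        lebesgue_null (ball_inf (b, U) r `\` F) &
        ball_inf (b, U) alpha^-1 `<=` F]) /\
  (fails_on lam Gamma2 (ball_inf (b, U) alpha^-1) \/
   exists theta : set (lasso_input R m N),
    [/\ open theta, theta !=set0, theta <> ball_inf (b, U) alpha^-1,
        theta `<=` ball_inf (b, U) r & fails_on lam Gamma2 theta]).

Proof.
have /andP[a0 _] := halpha; have /andP[ar rk] := hr.
have stspE := cond_UL_stsp hcond a0.
(* As r exceeds the infimum, some q at distance less than r has a solution whose support differs
   from that of a solution x at [(b, U)]. *)
have : (stsp lam (b, U) < r%:E)%E by rewrite stspE lte_fin.
move=> /ereal_inf_lt[_ [d [d0 [q [x [x' [sx sx' qd1 qd2 xx']]]]] <-]].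
rewrite lte_fin => dr; set S := supp x.
(* Another support at p would make the distance from p to [(b, U)] admissible in the infimum, though
   it is below [alpha^-1]. *)
have onlyS p : ball_inf (b, U) alpha^-1 p -> Xi lam p `<=` [set S].
  move=> Bp T [z sz <-]; apply: contrapT => zS; move: Bp; rewrite /ball_inf /=.
  apply/negP; rewrite -leNgt -lee_fin -stspE; apply: ereal_inf_lbound.
  exists (Num.max `|p.1 - b| `|p.2 - U|) => //; split.
    by rewrite le_max normr_ge0.
  exists p, x, z; split=> //; rewrite ?le_max ?lexx ?orbT//.
  by move=> E; apply: zS.
have Bq : ball_inf (b, U) r q.
  by apply/ball_infP; split; exact: le_lt_trans dr.
have subB : ball_inf (b, U) alpha^-1 `<=` ball_inf (b, U) r.
  by move=> p; rewrite /ball_inf /= => /lt_trans; exact.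
have Bc : ball_inf (b, U) alpha^-1 (b, U).
  by apply/ball_infP; rewrite /= !subrr !normr0.
(* Perturbing q excludes S on a whole neighbourhood, which therefore contains dyadic inputs. *)
have [q1 Bq1 nq1] := near_excluded_support hlam Bq sx' (fun E => xx' (esym E)).
pose O := [set p | ball_inf (b, U) r p /\ ~ Xi lam p S].
have nO : nbhs q1 O by apply: filterI nq1; exact: nbhs_ball_inf.
split.
  have [p1 [[Bp1 nS1] y1 A1]] := dyadic_input_dense nO.
  have [p0 [Bp0 y0 A0]] := dyadic_input_dense (nbhs_ball_inf Bc).
  (* Correctness on dyadic inputs pins the outputs: S at [p0], something else at [p1]. *)
  have r0 : Gamma1 (fun=> p0) = S.
    by apply: (onlyS _ Bp0); apply: hcorrect => //; exact/hball/subB.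
  have r1 : Gamma1 (fun=> p1) <> S.
    by move=> E; apply: nS1; rewrite -E; apply: hcorrect => //; exact: hball.
  exists [set p | ball_inf (b, U) r p /\ exists s,
    [/\ delta1_info Omega s, corresponds s p & ~ Xi lam p (Gamma1 s)]]; split.
  - split; first by move=> p [/hball].
    by move=> p [].
  - have S01 : Gamma1 (fun=> p0) <> Gamma1 (fun=> p1).
      by rewrite r0 => E; exact: r1.
    apply: lebesgue_null_sub (two_supports_null hlam hm (`|b| + `|U| + r) S01).
    (* Off F, imitating [p0] and imitating [p1] must both give a valid support at p. *)
    move=> p [Bp nF]; split; first exact: (ball_inf_entry Bp).
      have [s [ds sp <-]] := finite_precision_confuses hGamma1 rk hball Bp (subB _ Bp0).
      by apply: contrapT => ns; apply: nF; split=> //; exists s.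
    have [s [ds sp <-]] := finite_precision_confuses hGamma1 rk hball Bp Bp1.
    by apply: contrapT => ns; apply: nF; split=> //; exists s.
  - move=> p Bp; split; first exact: subB.
    have [s [ds sp sE]] := finite_precision_confuses hGamma1 rk hball (subB _ Bp) Bp1.
    by exists s; split=> // /(onlyS _ Bp); rewrite sE.
have confused p : ball_inf (b, U) r p -> exists s,
    [/\ delta1_info Omega s, corresponds s p & Gamma2 s = Gamma2 (fun=> (b, U))].
  by move=> Bp; exact: (finite_precision_confuses hGamma2 rk hball Bp (subB _ Bc)).
(* The output on the constant sequence [(b, U)] can be forced on the whole ball. If it is S, it is
   wrong on [O]; otherwise it is wrong below radius [alpha^-1]. *)
have [r2|r2] := pselect (Gamma2 (fun=> (b, U)) = S); [right|left].
  exists (interior O); split.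
  - exact: open_interior.
  - by exists q1.
  (* The centre [(b, U)] is not in [O], since x is a solution there with support S. *)
  - move=> E; have : O (b, U) by apply: interior_subset; rewrite E.
    by move=> [_]; apply; exists x.
  - by move=> p /interior_subset[].
  - split=> p /interior_subset[Bp nS]; first exact: hball.
    by have [s [ds sp sE]] := confused _ Bp; exists s; split=> //; rewrite sE r2.
split=> p Bp; first exact/hball/subB.
have [s [ds sp sE]] := confused _ (subB _ Bp).
by exists s; split=> // /(onlyS _ Bp); rewrite sE.
Qed.
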